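(* Let $G$ be a finite simple graph with vertex set $V\neq\emptyset$ and no isolated vertices, and let $\widehat h:=\min\{h,\,1-\bar h\}$, where $h$ is the Cheeger constant and $\bar h$ the dual Cheeger constant of $G$. Then $$1-\sqrt{1-\widehat h^{\,2}}\ \le\ 1-\tau\ \le\ 2\widehat h,$$ or equivalently, $$1-2\widehat h\ \le\ \tau\ \le\ \sqrt{1-\widehat h^{\,2}}.$$
   Context: For a simple graph $G=(V,E)$ on $n$ vertices without isolated vertices, with adjacency matrix $A$ and diagonal degree matrix $D$, the normalized Laplacian is $L:=\mathrm{Id}-D^{-1}A$, with real eigenvalues (counted with multiplicity) $0=\lambda_1\le\lambda_2\le\dots\le\lambda_n\le2$. Set $\tau:=\max_{i\ne1}|1-\lambda_i|$, the maximum being over indices $i\in\{2,\dots,n\}$. For $U,S\subseteq V$, $e(U,S)$ is the number of edges $\{u,s\}\in E$ with $u\in U$, $s\in S$; $\overline S:=V\setminus S$; $\mathrm{vol}(S):=\sum_{v\in S}\deg v$. The Cheeger constant is $$h:=\min_{\emptyset\ne S\subsetneq V}\frac{e(S,\overline S)}{\min\{\mathrm{vol}(S),\mathrm{vol}(\overline S)\}}.$$ The dual Cheeger constant is $$\bar h:=\max\frac{2\,e(S_1,S_2)}{\mathrm{vol}(S_1)+\mathrm{vol}(S_2)},$$ the maximum being over all partitions $V=S_1\sqcup S_2\sqcup S_3$ into pairwise disjoint sets with $S_1,S_2\ne\emptyset$ ($S_3$ may be empty). *)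

(* Defs.v *)
From HB Require Import structures.
From mathcomp Require Import all_boot all_order all_algebra.
From mathcomp Require Import polyrcf.
From mathcomp Require Import reals.

Set Implicit Arguments.
Unset Strict Implicit.
Unset Printing Implicit Defensive.

Import Order.TTheory GRing.Theory Num.Theory.
Local Open Scope ring_scope.

(* A simple graph is a symmetric irreflexive [e : rel T] on a [finType].      *)
Section Graph.
Variables (T : finType) (e : rel T).
Implicit Types (S U : {set T}) (P : {set T} * {set T}).

Definition no_isolated_vertex : Prop := forall v : T, exists w : T, e v w.

Definition degree (v : T) : nat := #|[set w | e v w]|.

Definition vol S : nat := (\sum_(v in S) degree v)%N.

(* Edges are unordered pairs, so an edge with both ends in [U :&: S] is       *)
(* counted once.                                                              *)
Definition edges_between U S : {set {set T}} :=
  [set [set u; s] | u in U, s in S & e u s].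

Definition num_edges U S : nat := #|edges_between U S|.

Variable R : realType.

Definition adjacency_mx : 'M[R]_#|T| :=
  \matrix_(i, j) (e (enum_val i) (enum_val j))%:R.

Definition degree_mx : 'M[R]_#|T| :=
  diag_mx (\row_i (degree (enum_val i))%:R).

Definition laplacian : 'M[R]_#|T| :=
  1%:M - invmx degree_mx *m adjacency_mx.

(* Ratios [e(S, ~S) / min(vol S, vol ~S)] are at most 1, so when some         *)
(* admissible [S] exists the default value 1 does not affect the minimum.     *)
Definition cheeger : R :=
  \big[Num.min/1]_(S : {set T} | (S != set0) && (S \proper [set: T]))
    ((num_edges S (~: S))%:R / (minn (vol S) (vol (~: S)))%:R).

(* [P] is the pair (S_1, S_2), and S_3 is the complement of their union. The  *)
(* ratios are nonnegative, so when some admissible pair exists the default    *)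
(* value 0 does not affect the maximum.                                       *)
Definition dual_cheeger : R :=
  \big[Num.max/0]_(P : {set T} * {set T} |
                     [&& P.1 != set0, P.2 != set0 & [disjoint P.1 & P.2]])
    ((2 * num_edges P.1 P.2)%N%:R / (vol P.1 + vol P.2)%N%:R).

Definition cheeger_min : R := Num.min cheeger (1 - dual_cheeger).

End Graph.

(* The real eigenvalues of [M] in nondecreasing order, each repeated          *)
(* according to its multiplicity as a root of the characteristic polynomial;  *)
(* [rootsR p] is the strictly increasing sequence of all real roots of [p].   *)
Definition spectrum (R : realType) (n : nat) (M : 'M[R]_n) : seq R :=
  flatten [seq nseq (mup x (char_poly M)) x | x <- rootsR (char_poly M)].

(* [behead] drops lambda_1 only, keeping further copies of the same value.    *)
Definition tau (T : finType) (e : rel T) (R : realType) : R :=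
  \big[Num.max/0]_(x <- behead (spectrum (laplacian e R))) `|1 - x|.

Arguments tau [T] e R.
Arguments cheeger [T] e R.
Arguments dual_cheeger [T] e R.
Arguments cheeger_min [T] e R.

(* Main.v *)
Require Import Defs.
From mathcomp Require Import all_boot all_order all_fingroup all_algebra.
From mathcomp Require Import zify ring lra polyrcf complex reals.
Set Implicit Arguments.
Unset Strict Implicit.
Unset Printing Implicit Defensive.
Import Order.TTheory GRing.Theory Num.Theory.
Local Open Scope ring_scope.

(** Write A(f,g) for the sum of f(u) g(w) over ordered pairs of adjacent
    vertices and D(f,g) for the sum of deg(u) f(u) g(u).  An eigenvector of the
    Laplacian with eigenvalue x satisfies A(g,f) = (1 - x) D(g,f) for all g, so
    the eigenvalues are controlled by comparing A with D.

    The Laplacian is similar to a real symmetric matrix, hence diagonalizable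
    over the reals, and the list of eigenvalues in the statement indexes a basis
    of eigenfunctions ([laplacian_eigenfunctions]).  Eigenfunctions for distinct
    eigenvalues are D-orthogonal, so on a combination of eigenfunctions whose
    eigenvalues are all at least (at most) x, A is at most (at least) (1 - x) D
    ([adj_form_comb_le], [adj_form_comb_ge]).

    Upper bounds on tau.  Both Cheeger inequalities come from one estimate,
    [adj_form_le_threshold]: if r is a set of edges and f >= 0 is such
    that every superlevel set S of f spans few edges of r relative to vol(S),
    then the sum of f(u) f(w) over r is small relative to D(f,f).  It is proved
    by writing f^2 as a positive combination of indicators of superlevel sets and
    applying Cauchy-Schwarz.
    - For the Cheeger constant, r is the whole edge set and f is the positive or
      negative part of g - c, where g is D-orthogonal to constants and c is a
      median of g ([adj_form_le_cheeger]).  Two eigenfunctions with eigenvalues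
      at most x always have such a g in their span.
    - For the dual Cheeger constant, r is the set of edges across which g changes
      sign and f = |g|; the superlevel sets of f then come divided into a positive
      and a negative part ([adj_form_ge_dual_cheeger]).  Edges inside r are the
      only ones that make A(g,g) negative, and treating the others as if they
      led to a vertex where f vanishes gives the sharp constant.

    Lower bounds on tau.  By the Courant-Fischer argument the second eigenvalue is
    tested on the span of the indicators of S and of its complement, and the
    largest one on the difference of the indicators of S_1 and S_2. *)

Lemma degree_gt0 (T : finType) (e : rel T) v :
  no_isolated_vertex e -> (0 < degree e v)%N.
Proof.
by move=> e_iso; have [w ew] := e_iso v; apply/card_gt0P; exists w; rewrite inE.
Qed.

(** * Adjacency and degree forms of a graph *)

Section Forms.
Variables (R : realType) (T : finType) (e : rel T).
Implicit Types (r : rel T) (f g : T -> R).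

Definition adj_form r f g : R := \sum_u \sum_w (r u w)%:R * f u * g w.

Definition deg_form f g : R := \sum_u (degree e u)%:R * f u * g u.

Lemma degreeE u : (degree e u)%:R = \sum_w (e u w)%:R :> R.
Proof.
rewrite /degree -sum1_card natr_sum big_mkcond /=.
by apply: eq_bigr => w _; rewrite inE; case: (e u w).
Qed.

Lemma adj_formC r f g : symmetric r -> adj_form r f g = adj_form r g f.
Proof.
move=> r_sym; rewrite /adj_form exchange_big; apply: eq_bigr => u _.
by apply: eq_bigr => w _; rewrite r_sym mulrAC.
Qed.

Lemma deg_formC f g : deg_form f g = deg_form g f.
Proof. by apply: eq_bigr => u _; rewrite mulrAC. Qed.

Lemma deg_form_ge0 f : 0 <= deg_form f f.
Proof. by apply: sumr_ge0 => u _; rewrite -mulrA mulr_ge0 // -expr2 sqr_ge0. Qed.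

Lemma deg_form_gt0 f v : no_isolated_vertex e -> f v != 0 -> 0 < deg_form f f.
Proof.
move=> e_iso fv; rewrite /deg_form (bigD1 v) //= ltr_pwDl //; last first.
  by apply: sumr_ge0 => u _; rewrite -mulrA mulr_ge0 // -expr2 sqr_ge0.
rewrite -mulrA mulr_gt0 //; last by rewrite -expr2 exprn_even_gt0.
by rewrite ltr0n degree_gt0.
Qed.

Lemma sum_edges_l f : \sum_u \sum_w (e u w)%:R * f u = \sum_u (degree e u)%:R * f u.
Proof. by apply: eq_bigr => u _; rewrite -mulr_suml degreeE. Qed.

Lemma sum_edges_r f : symmetric e ->
  \sum_u \sum_w (e u w)%:R * f w = \sum_u (degree e u)%:R * f u.
Proof.
move=> e_sym; rewrite exchange_big -sum_edges_l; apply: eq_bigr => u _.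
by apply: eq_bigr => w _; rewrite e_sym.
Qed.

(** ** Combinations of eigenfunctions *)

Section Eigen.
Variables (n : nat) (lam : 'I_n -> R) (f : 'I_n -> T -> R).
Hypothesis e_sym : symmetric e.
Hypothesis f_eigen : forall k v,
  \sum_w (e v w)%:R * f k w = (1 - lam k) * (degree e v)%:R * f k v.

Definition comb (c : 'I_n -> R) v := \sum_k c k * f k v.

Lemma adj_form_eigen g k : adj_form e g (f k) = (1 - lam k) * deg_form g (f k).
Proof.
rewrite /adj_form /deg_form mulr_sumr; apply: eq_bigr => u _.
under eq_bigr => w _ do rewrite mulrAC mulrC.
by rewrite -mulr_sumr f_eigen; ring.
Qed.

Lemma deg_form_combr g c : deg_form g (comb c) = \sum_k c k * deg_form g (f k).
Proof.
rewrite /deg_form; under eq_bigr => u _ do rewrite mulr_sumr.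
rewrite exchange_big; apply: eq_bigr => k _; rewrite mulr_sumr.
by apply: eq_bigr => u _; ring.
Qed.

Lemma adj_form_combr g c :
  adj_form e g (comb c) = \sum_k c k * (1 - lam k) * deg_form g (f k).
Proof.
transitivity (\sum_k c k * adj_form e g (f k)); last first.
  by apply: eq_bigr => k _; rewrite adj_form_eigen mulrA.
rewrite /adj_form; under eq_bigr => u _ do under eq_bigr => w _ do rewrite mulr_sumr.
under eq_bigr => u _ do rewrite exchange_big.
rewrite exchange_big; apply: eq_bigr => k _; rewrite mulr_sumr.
apply: eq_bigr => u _; rewrite mulr_sumr.
by apply: eq_bigr => w _; ring.
Qed.

Lemma eigen_orthogonal i j : lam i != lam j -> deg_form (f i) (f j) = 0.
Proof.
move=> neq; have := adj_form_eigen (f i) j; rewrite adj_formC // adj_form_eigen deg_formC.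
move=> /eqP; rewrite -subr_eq0 -mulrBl mulf_eq0 => /orP[/eqP h|/eqP h].
  by case/eqP: neq; lra.
by rewrite // deg_formC.
Qed.

(** Replacing c_k by c_k sqrt(y(lam k)) turns the sum into D(h,h) for some h:
    only pairs of eigenfunctions with the same eigenvalue contribute, and for
    those the two square roots multiply to y(lam k).  This makes it unnecessary
    to orthogonalize the basis inside the eigenspaces. *)
Lemma eigen_form_ge0 c (y : R -> R) : (forall k, c k != 0 -> 0 <= y (lam k)) ->
  0 <= \sum_k c k * y (lam k) * deg_form (comb c) (f k).
Proof.
move=> y_ge0; pose a k := c k * Num.sqrt (y (lam k)).
suff -> : \sum_k c k * y (lam k) * deg_form (comb c) (f k) = deg_form (comb a) (comb a).
  exact: deg_form_ge0.
rewrite deg_form_combr; apply: eq_bigr => j _; rewrite 2!(deg_formC _ (f j)) !deg_form_combr.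
rewrite !mulr_sumr; apply: eq_bigr => i _; rewrite /a.
have [eq_ij|/eigen_orthogonal] := eqVneq (lam i) (lam j); last first.
  by rewrite deg_formC => ->; rewrite !mulr0.
have [->|cj] := eqVneq (c j) 0; first by rewrite !mul0r.
rewrite eq_ij -[y _ in LHS]sqr_sqrtr ?y_ge0 //; ring.
Qed.

Lemma adj_form_comb_le c x : (forall k, c k != 0 -> x <= lam k) ->
  adj_form e (comb c) (comb c) <= (1 - x) * deg_form (comb c) (comb c).
Proof.
move=> cx; have := @eigen_form_ge0 c (fun t => t - x).
move=> /(_ (fun k ck => etrans (subr_ge0 _ _) (cx k ck))) ge0.
rewrite -subr_ge0; suff -> : (1 - x) * deg_form (comb c) (comb c) - adj_form e (comb c) (comb c) =
  \sum_k c k * (lam k - x) * deg_form (comb c) (f k) by [].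
rewrite adj_form_combr [in LHS](deg_form_combr (comb c) c) mulr_sumr -sumrB.
by apply: eq_bigr => k _; ring.
Qed.

Lemma adj_form_comb_ge c x : (forall k, c k != 0 -> lam k <= x) ->
  (1 - x) * deg_form (comb c) (comb c) <= adj_form e (comb c) (comb c).
Proof.
move=> cx; have := @eigen_form_ge0 c (fun t => x - t).
move=> /(_ (fun k ck => etrans (subr_ge0 _ _) (cx k ck))) ge0.
rewrite -subr_ge0; suff -> : adj_form e (comb c) (comb c) - (1 - x) * deg_form (comb c) (comb c) =
  \sum_k c k * (x - lam k) * deg_form (comb c) (f k) by [].
rewrite adj_form_combr [in LHS](deg_form_combr (comb c) c) mulr_sumr -sumrB.
by apply: eq_bigr => k _; ring.
Qed.

End Eigen.
End Forms.

(** * Rounding a function to its superlevel sets *)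

(** By Lagrange's identity, the difference of the two sides is half a sum of
    squares. *)
Lemma cauchy_schwarz (R : realDomainType) (I : finType) (a b : I -> R) :
  (\sum_i a i * b i) ^+ 2 <= (\sum_i a i ^+ 2) * (\sum_i b i ^+ 2).
Proof.
set X := \sum_i _; set A := \sum_i _; set B := \sum_i _.
have lagrange : \sum_i \sum_j (a i * b j - a j * b i) ^+ 2 = (A * B - X ^+ 2) *+ 2.
  transitivity (A * B + B * A - (X * X) *+ 2); last by ring.
  rewrite 3![in RHS]mulr_suml -sumrMnl -big_split -sumrB; apply: eq_bigr => i _.
  rewrite /= !mulr_sumr -sumrMnl -big_split -sumrB; apply: eq_bigr => j _ /=.
  by ring.
have : 0 <= (A * B - X ^+ 2) *+ 2.
  by rewrite -lagrange; do 2!apply: sumr_ge0 => ? _; rewrite sqr_ge0.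
by rewrite pmulrn_lge0 // subr_ge0.
Qed.

(** Discrete layer-cake formula: for sorted values, take the thresholds to be the
    values themselves and the weights to be the successive gaps.  Since it holds
    on a list of values, it also expresses the minimum of two of them. *)
Lemma layer_cake (R : realDomainType) (s : seq R) : all (<=%R 0) s ->
  exists2 L : seq (R * R), forall p, p \in L -> 0 <= p.1 /\ 0 < p.2 &
    {in s, forall x, x = \sum_(p <- L) p.1 * (p.2 <= x)%R%:R}.
Proof.
suff shifted (t : seq R) : sorted <=%R t -> forall a, all (<=%R a) t ->
    exists2 L : seq (R * R), forall p, p \in L -> 0 <= p.1 /\ a < p.2 &
      {in t, forall x, x - a = \sum_(p <- L) p.1 * (p.2 <= x)%R%:R}.
  move=> s0; have [||L L0 sL] := shifted (sort <=%R s) _ 0.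
  - exact/sort_sorted/le_total.
  - by rewrite all_sort.
  by exists L => // x xs; rewrite -sL ?subr0 // mem_sort.
elim: t => [|b t IHt] /= t_sorted a; first by exists [::].
move=> /andP[ab _]; have bt := order_path_min le_trans t_sorted.
have [L Lgt tL] := IHt (path_sorted t_sorted) b bt.
have {tL} btL : {in b :: t, forall x, x - b = \sum_(p <- L) p.1 * (p.2 <= x)%R%:R}.
  move=> x; rewrite inE => /predU1P[->|]; last exact: tL.
  rewrite subrr big1_seq // => p /andP[_ /Lgt[_ bp]].
  by rewrite leNgt bp mulr0.
move: ab; rewrite le_eqVlt => /predU1P[->|ab]; first by exists L.
exists ((b - a, b) :: L) => [p|x xbt].
  rewrite inE => /predU1P[->|/Lgt[p1 p2]] /=; first by rewrite subr_ge0 ltW.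
  by rewrite p1 (lt_trans ab).
rewrite big_cons -btL //= (_ : b <= x) ?mulr1; first by ring.
by move: xbt; rewrite inE => /predU1P[->//|/(allP bt)].
Qed.

Section Threshold.
Variables (R : realType) (T : finType) (e : rel T).

Definition indicator (S : {set T}) (v : T) : R := (v \in S)%:R.

Lemma volE (S : {set T}) : (vol e S)%:R = \sum_u (degree e u)%:R * indicator S u.
Proof.
rewrite /vol natr_sum big_mkcond; apply: eq_bigr => u _ /=.
by rewrite /indicator; case: (u \in S); rewrite ?mulr1 ?mulr0.
Qed.

(** With phi = f^2, give each ordered adjacent pair (u,w) the cost
    |phi(u) - phi(w)| if it lies in r and phi(u) + phi(w) otherwise.  The
    layer-cake formula, applied to phi(u) and to min(phi(u),phi(w)), turns the
    hypothesis on superlevel sets into: the total cost is at least 2k D(f,f).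
    The cost factors as a product of |f(u) - f(w)| and f(u) + f(w) on r, and as
    the square of sqrt(phi(u) + phi(w)) off r.  The squares of the two factors
    sum to 2 D(f,f) - 2 G and 2 D(f,f) + 2 G, where G is the r-form of f, so
    Cauchy-Schwarz gives k^2 D(f,f)^2 <= D(f,f)^2 - G^2. *)
Lemma adj_form_le_threshold (r : rel T) (f : T -> R) (k : R) :
  symmetric e -> subrel r e -> (forall v, 0 <= f v) -> 0 <= k <= 1 ->
  (forall t, 0 < t -> let S := [set v | t <= f v ^+ 2] in
     adj_form r (indicator S) (indicator S) <= (1 - k) * (vol e S)%:R) ->
  adj_form r f f <= Num.sqrt (1 - k ^+ 2) * deg_form e f f.
Proof.
move=> e_sym r_e f0 /andP[k0 k1] rS; pose phi v := f v ^+ 2.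
set G := adj_form r f f; set N := deg_form e f f.
have GE : G = \sum_u \sum_w (r u w)%:R * (f u * f w).
  by do 2!apply: eq_bigr => ? _; rewrite mulrA.
have NE : N = \sum_u (degree e u)%:R * phi u.
  by apply: eq_bigr => u _; rewrite -mulrA.
pose m := \sum_u \sum_w (r u w)%:R * Num.min (phi u) (phi w).
have m_le : m <= (1 - k) * N.
  have [|L L0 cake] := @layer_cake R (codom phi).
    by apply/allP => _ /codomP[v ->]; rewrite sqr_ge0.
  pose S (p : R * R) := [set v | p.2 <= phi v].
  have phiE v : phi v = \sum_(p <- L) p.1 * indicator (S p) v.
    rewrite [LHS]cake ?codom_f //; apply: eq_bigr => p _.
    by rewrite /indicator inE.
  have minE u w :
      Num.min (phi u) (phi w) = \sum_(p <- L) p.1 * (indicator (S p) u * indicator (S p) w).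
    rewrite [LHS]cake; last by rewrite /Num.min; case: ifP; rewrite codom_f.
    by apply: eq_bigr => p _; rewrite le_min -mulnb natrM /indicator !inE.
  have -> : m = \sum_(p <- L) p.1 * adj_form r (indicator (S p)) (indicator (S p)).
    under [RHS]eq_bigr => p _ do rewrite mulr_sumr.
    rewrite [RHS]exchange_big; apply: eq_bigr => u _.
    under [RHS]eq_bigr => p _ do rewrite mulr_sumr.
    rewrite [RHS]exchange_big; apply: eq_bigr => w _.
    by rewrite minE mulr_sumr; apply: eq_bigr => p _; ring.
  have -> : N = \sum_(p <- L) p.1 * (vol e (S p))%:R.
    rewrite NE; under [RHS]eq_bigr => p _ do rewrite volE mulr_sumr.
    rewrite [RHS]exchange_big; apply: eq_bigr => u _.
    by rewrite phiE mulr_sumr; apply: eq_bigr => p _; ring.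
  rewrite mulr_sumr big_seq [leRHS]big_seq; apply: ler_sum => p /L0[p1 p2].
  by rewrite mulrCA ler_wpM2l //; apply: rS.
have N0 : 0 <= N by apply: deg_form_ge0.
pose a (p : T * T) : R := (e p.1 p.2)%:R *
  if r p.1 p.2 then `|f p.1 - f p.2| else Num.sqrt (phi p.1 + phi p.2).
pose b (p : T * T) : R := (e p.1 p.2)%:R *
  if r p.1 p.2 then f p.1 + f p.2 else Num.sqrt (phi p.1 + phi p.2).
have sumE (F : T * T -> R) (c : R) (H : T -> T -> R) :
    (forall u w, F (u, w) = (e u w)%:R * phi u + (e u w)%:R * phi w -
       c * ((r u w)%:R * H u w)) ->
    \sum_p F p = 2 * N - c * \sum_u \sum_w (r u w)%:R * H u w.
  move=> FE; transitivity (\sum_u \sum_w F (u, w)).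
    by rewrite pair_big; apply: eq_bigr => -[].
  under eq_bigr => u _ do
    (under eq_bigr => w _ do rewrite FE; rewrite sumrB big_split /= -mulr_sumr).
  by rewrite sumrB big_split /= sum_edges_l sum_edges_r // -NE -mulr_sumr; ring.
have s0 u w : 0 <= phi u + phi w by rewrite addr_ge0 ?sqr_ge0.
(* The total cost, with m the sum of min(phi u, phi w) over r. *)
have cutE : \sum_p a p * b p = 2 * N - 2 * m.
  apply: sumE => u w; rewrite /a /b /=; have := @r_e u w.
  case: (r u w) => [->//|_]; last first.
    by case: (e u w); rewrite ?mul0r ?mul1r -?expr2 ?sqr_sqrtr //; ring.
  have -> : f u + f w = `|f u + f w| by rewrite ger0_norm ?addr_ge0.
  rewrite !mul1r -normrM -subr_sqr -/(phi u) -/(phi w).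
  by case: ltrP => h; ring.
have aE : \sum_p a p ^+ 2 = 2 * N - 2 * G.
  rewrite GE; apply: sumE => u w; rewrite /a /=; have := @r_e u w.
  case: (r u w) => [->//|_]; last first.
    by case: (e u w); rewrite ?mul0r ?mul1r ?sqr_sqrtr //; ring.
  by rewrite !mul1r real_normK ?num_real // /phi; ring.
have bE : \sum_p b p ^+ 2 = 2 * N + 2 * G.
  rewrite -[2 * G]opprK -mulNr GE.
  apply: sumE => u w; rewrite /b /=; have := @r_e u w.
  case: (r u w) => [->//|_]; last first.
    by case: (e u w); rewrite ?mul0r ?mul1r ?sqr_sqrtr //; ring.
  by rewrite !mul1r /phi; ring.
have := cauchy_schwarz a b; rewrite cutE aE bE => cs.
have kN : (k * N) ^+ 2 <= (N - m) ^+ 2.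
  by rewrite ler_sqr ?nnegrE ?mulr_ge0 //; nra.
have k2 : 0 <= 1 - k ^+ 2 by nra.
rewrite -[N]ger0_norm // -sqrtr_sqr -sqrtrM // (le_trans (ler_norm _)) //.
by rewrite -sqrtr_sqr ler_wsqrtr //; nra.
Qed.

End Threshold.

(** * Isoperimetric constants and the adjacency form *)

Section Combinatorics.
Variables (R : realType) (T : finType) (e : rel T).
Hypothesis e_sym : symmetric e.
Implicit Types (S : {set T}) (f g : T -> R).
Local Notation ind := (@indicator R T).
Local Notation dform := (deg_form e).
Local Notation h := (cheeger e R).
Local Notation hbar := (dual_cheeger e R).

(** For disjoint sets each unordered edge is counted by exactly one ordered
    pair in S1 x S2. *)
Lemma num_edgesE S1 S2 : [disjoint S1 & S2] ->
  (num_edges e S1 S2)%:R = adj_form e (ind S1) (ind S2).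
Proof.
move=> dis; pose A := [set p : T * T | [&& p.1 \in S1, p.2 \in S2 & e p.1 p.2]].
have -> : num_edges e S1 S2 = #|A|.
  rewrite /num_edges -(@card_in_imset _ _ (fun p : T * T => [set p.1; p.2]) A).
    congr #|pred_of_set _|; apply/setP => Z; apply/imset2P/imsetP.
      move=> [u w uS]; rewrite inE => /andP[wS euw] ->.
      by exists (u, w); rewrite // inE uS wS.
    move=> [[u w]]; rewrite inE /= => /and3P[uS wS euw] ->.
    by exists u w; rewrite // inE wS.
  move=> [u w] [u' w']; rewrite !inE /= => /and3P[uS wS _] /and3P[u'S w'S _] eqZ.
  have notboth x : x \in S1 -> x \in S2 -> False.
    by move=> x1 x2; have := disjointFr dis x1; rewrite x2.
  have : u \in [set u'; w'] by rewrite -eqZ set21.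
  have : w \in [set u'; w'] by rewrite -eqZ set22.
  rewrite !inE => /orP[]/eqP ww /orP[]/eqP uu; subst => //.
  - by case: (notboth u').
  - by case: (notboth u').
  - by case: (notboth w').
rewrite /adj_form pair_big -sum1_card natr_sum big_mkcond /=.
apply: eq_bigr => -[u w] _; rewrite inE /ind /=.
by case: (u \in S1); case: (w \in S2); case: (e u w); rewrite ?mulr1 ?mulr0 ?mul0r.
Qed.

Lemma indicator_ge0 S v : 0 <= ind S v. Proof. exact: ler0n. Qed.

Lemma indicatorC S v : ind (~: S) v = 1 - ind S v.
Proof. by rewrite /indicator inE; case: (v \in S); rewrite ?subrr ?subr0. Qed.

Lemma indicator01 S v : ind S v = 0 \/ ind S v = 1.
Proof. by rewrite /indicator; case: (v \in S); [right|left]. Qed.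

Lemma vol_split S :
  (vol e S)%:R = adj_form e (ind S) (ind S) + adj_form e (ind S) (ind (~: S)).
Proof.
rewrite volE -sum_edges_l -big_split; apply: eq_bigr => u _ /=.
by rewrite -big_split; apply: eq_bigr => w _; rewrite indicatorC /=; ring.
Qed.

Lemma num_edges_le_vol S1 S2 : [disjoint S1 & S2] ->
  (2 * num_edges e S1 S2 <= vol e S1 + vol e S2)%N.
Proof.
have le_vol S S' : [disjoint S & S'] -> (num_edges e S S' <= vol e S)%N.
  move=> dis; rewrite -(ler_nat R) num_edgesE // volE -sum_edges_l.
  do 2!apply: ler_sum => ? _; rewrite ler_piMr ?mulr_ge0 ?indicator_ge0 //.
  by rewrite /ind; case: (_ \in _).
move=> dis; rewrite mul2n -addnn leq_add ?le_vol //.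
rewrite -(ler_nat R) num_edgesE // adj_formC // -num_edgesE 1?disjoint_sym //.
by rewrite ler_nat le_vol // disjoint_sym.
Qed.

Lemma vol_sub S S' : S \subset S' -> (vol e S <= vol e S')%N.
Proof.
move=> sub; rewrite /vol [leqRHS](big_setID S) /= (setIidPr sub).
exact: leq_addr.
Qed.

Lemma vol_setC S : (vol e S + vol e (~: S) = vol e [set: T])%N.
Proof. by rewrite /vol [RHS](big_setID S) /= setTI setTD. Qed.

Lemma cheeger_bounds : 0 <= h <= 1.
Proof.
rewrite /cheeger bigmin_le_id andbT; apply: le_bigmin => // S _.
by rewrite divr_ge0.
Qed.

(** If vol(S) = 0 the left side vanishes; otherwise S and its complement have
    positive volume, which makes S admissible in the Cheeger constant. *)
Lemma cheeger_le S : (vol e S <= vol e (~: S))%N ->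
  h * (vol e S)%:R <= (num_edges e S (~: S))%:R.
Proof.
move=> le_vol; have [->|] := eqVneq (vol e S) 0%N; first by rewrite mulr0.
rewrite -lt0n => vol_gt0; rewrite -ler_pdivlMr ?ltr0n //.
apply: (bigmin_inf S); last by rewrite (minn_idPl le_vol).
rewrite properT; apply/andP; split.
  by apply: contraTneq vol_gt0 => ->; rewrite /vol big_set0.
by apply: contraTneq (leq_trans vol_gt0 le_vol) => ->; rewrite /vol setCT big_set0.
Qed.

Lemma dual_cheeger_bounds : 0 <= hbar <= 1.
Proof.
rewrite /dual_cheeger bigmax_ge_id; apply: bigmax_le => // -[S1 S2] /and3P[_ _ dis].
set x := (_ + _)%N; have [->|] := eqVneq x 0%N; first by rewrite invr0 mulr0.
rewrite -lt0n => x_gt0; rewrite ler_pdivrMr ?ltr0n // mul1r ler_nat.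
exact: num_edges_le_vol.
Qed.

(** If S1 or S2 is empty the pair is not admissible, but then there are no edges
    between them. *)
Lemma dual_cheeger_ge S1 S2 : [disjoint S1 & S2] ->
  2 * (num_edges e S1 S2)%:R <= hbar * ((vol e S1)%:R + (vol e S2)%:R).
Proof.
move=> dis; have /andP[hbar_ge0 _] := dual_cheeger_bounds.
have [x0|] := eqVneq (2 * num_edges e S1 S2)%N 0%N.
  by rewrite -natrM x0 mulr_ge0 // addr_ge0.
rewrite -natrM -natrD -lt0n => x_gt0.
rewrite -ler_pdivrMr ?ltr0n ?(leq_trans x_gt0) ?num_edges_le_vol //.
rewrite /dual_cheeger; apply: (@bigmax_sup _ _ _ _ (S1, S2)) => /=; last by [].
rewrite dis andbT.
have gt0 : (0 < num_edges e S1 S2)%N by rewrite muln_gt0 in x_gt0.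
have /card_gt0P[Z /imset2P[u w uS]] := gt0; rewrite inE => /andP[wS _] _.
by apply/andP; split; apply/set0Pn; [exists u|exists w].
Qed.

Lemma deg_form1 f : dform f (fun=> 1) = \sum_u (degree e u)%:R * f u.
Proof. by apply: eq_bigr => u _; rewrite mulr1. Qed.

(** Superlevel sets of f lie in its support, which has at most half the volume,
    so the Cheeger constant bounds their boundaries from below. *)
Lemma adj_form_le_half f : (forall v, 0 <= f v) ->
  (2 * vol e [set v | (0 < f v)%R] <= vol e [set: T])%N ->
  adj_form e f f <= Num.sqrt (1 - h ^+ 2) * dform f f.
Proof.
move=> f0 half; apply: adj_form_le_threshold => //; first exact: cheeger_bounds.
move=> t t0; set S := [set v | _]; rewrite /=.
have S_sub : S \subset [set v | 0 < f v].
  apply/subsetP => v; rewrite !inE => tv; rewrite lt_def f0 andbT.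
  by apply: contraTneq (lt_le_trans t0 tv) => ->; rewrite expr0n ltxx.
have le_vol : (vol e S <= vol e (~: S))%N.
  have := leq_trans _ half; rewrite -(vol_setC S) mul2n -addnn => /(_ (vol e S + vol e S)%N).
  by rewrite leq_add2l; apply; apply: leq_add; apply: vol_sub.
have := cheeger_le le_vol; rewrite num_edgesE; last by rewrite -setI_eq0 setICr.
by rewrite vol_split; lra.
Qed.

(** Take the least value g(m) such that the vertices with g <= g(m) carry at
    least half of the volume. *)
Lemma exists_median (g : T -> R) (v0 : T) : exists c : R,
  (2 * vol e [set v | (c < g v)%R] <= vol e [set: T])%N /\
  (2 * vol e [set v | (g v < c)%R] <= vol e [set: T])%N.
Proof.
pose P v := (vol e [set: T] <= 2 * vol e [set w | (g w <= g v)%R])%N.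
have [vmax _ maxP] := arg_maxP g (isT : predT v0).
have Pmax : P vmax.
  rewrite /P (_ : [set w | _] = [set: T]) ?mul2n -?addnn ?leq_addr //.
  by apply/setP => w; rewrite !inE; apply: maxP.
have [m Pm minP] := arg_minP g Pmax.
exists (g m); split.
  move: Pm; rewrite /P -(vol_setC [set w | (g w <= g m)%R]).
  have -> : ~: [set w | (g w <= g m)%R] = [set v | g m < g v].
    by apply/setP => w; rewrite !inE ltNge.
  by lia.
have [w wm|none] := pickP [pred w | g w < g m]; last first.
  rewrite (_ : [set v | _] = set0) /vol ?big_set0 //.
  by apply/setP => w; rewrite !inE; apply: none.
have [x xm maxx] := arg_maxP g wm.
have : ~~ P x by apply: contraTN xm => /minP; rewrite /= leNgt.
rewrite /P -ltnNge => /ltnW; apply: leq_trans; rewrite leq_mul2l /=.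
by apply: vol_sub; apply/subsetP => y; rewrite !inE => /maxx.
Qed.

(** Let p and q be the positive and negative parts of g - c, with c a median.
    Passing from g to g - c adds c^2 vol(V) to both A(g,g) and D(g,g), because g
    is orthogonal to constants; dropping the mixed terms of p and q only
    increases A.  The shift is harmless because sqrt(1 - h^2) <= 1. *)
Lemma adj_form_le_cheeger g : dform g (fun=> 1) = 0 ->
  adj_form e g g <= Num.sqrt (1 - h ^+ 2) * dform g g.
Proof.
move=> g1; have [v0 _|none] := pickP (fun _ : T => true); last first.
  by rewrite /adj_form /deg_form !big1 ?mulr0 // => u; have := none u.
have [c [c_hi c_lo]] := exists_median g v0.
pose p v := Num.max (g v - c) 0; pose q v := Num.max (c - g v) 0.
set s := Num.sqrt _.
have s1 : s <= 1.
  by rewrite -[leRHS]sqrtr1 ler_wsqrtr // lerBlDr lerDl sqr_ge0.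
have p0 v : 0 <= p v by rewrite le_max lexx orbT.
have q0 v : 0 <= q v by rewrite le_max lexx orbT.
have pq v : g v - c = p v - q v /\ p v * q v = 0.
  by rewrite /p /q; do 2!case: lerP => ?; split; lra || (try ring); nra.
have p_half : adj_form e p p <= s * dform p p.
  apply: adj_form_le_half => //; rewrite (_ : [set v | _] = [set v | c < g v]) //.
  by apply/setP => v; rewrite !inE lt_max ltxx orbF subr_gt0.
have q_half : adj_form e q q <= s * dform q q.
  apply: adj_form_le_half => //; rewrite (_ : [set v | _] = [set v | g v < c]) //.
  by apply/setP => v; rewrite !inE lt_max ltxx orbF subr_gt0.
pose V : R := \sum_u (degree e u)%:R.
have dshift : dform p p + dform q q = dform g g + c ^+ 2 * V.
  transitivity (dform g g - 2 * c * dform g (fun=> 1) + c ^+ 2 * V).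
    rewrite !mulr_sumr -sumrB -!big_split; apply: eq_bigr => u _ /=.
    have [e1 e2] := pq u.
    transitivity ((degree e u)%:R * ((p u - q u) ^+ 2 + 2 * (p u * q u))); first by ring.
    by rewrite -e1 e2; ring.
  by rewrite g1; ring.
have rshift : adj_form e g g + c ^+ 2 * V <= adj_form e p p + adj_form e q q.
  have <- : adj_form e (fun v => g v - c) (fun v => g v - c) = adj_form e g g + c ^+ 2 * V.
    transitivity (adj_form e g g - c * (\sum_u \sum_w (e u w)%:R * g u) -
      c * (\sum_u \sum_w (e u w)%:R * g w) + c ^+ 2 * V).
      rewrite /V; under [\sum_u (degree e u)%:R]eq_bigr => u _ do rewrite degreeE.
      rewrite !mulr_sumr -!sumrB -!big_split; apply: eq_bigr => u _ /=.
      rewrite !mulr_sumr -!sumrB -!big_split; apply: eq_bigr => w _ /=; ring.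
    by rewrite sum_edges_l sum_edges_r // -deg_form1 g1; ring.
  rewrite -big_split; apply: ler_sum => u _; rewrite -big_split; apply: ler_sum => w _ /=.
  have [-> _] := pq u; have [-> _] := pq w.
  rewrite -!mulrA -mulrDr ler_wpM2l // -subr_ge0.
  have -> : p u * p w + q u * q w - (p u - q u) * (p w - q w) = p u * q w + q u * p w.
    by ring.
  by rewrite addr_ge0 ?mulr_ge0.
have V0 : 0 <= V by apply: sumr_ge0.
have c2V : 0 <= (1 - s) * (c ^+ 2 * V).
  by apply: mulr_ge0; rewrite ?subr_ge0 // mulr_ge0 ?sqr_ge0.
have := congr1 ( *%R s) dshift; lra.
Qed.

(** Only the edges across which g changes sign contribute negatively to A(g,g),
    and inside a superlevel set of |g| these are edges between the part where
    g > 0 and the part where g < 0. *)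
Lemma adj_form_ge_dual_cheeger g :
  - (Num.sqrt (1 - (1 - hbar) ^+ 2) * dform g g) <= adj_form e g g.
Proof.
pose r : rel T := fun u w => e u w && (g u * g w < 0).
have dE : dform g g = dform (fun v => `|g v|) (fun v => `|g v|).
  by apply: eq_bigr => u _; rewrite -!mulrA -!expr2 real_normK ?num_real.
have lower : - adj_form r (fun v => `|g v|) (fun v => `|g v|) <= adj_form e g g.
  rewrite -sumrN; apply: ler_sum => u _; rewrite -sumrN; apply: ler_sum => w _.
  rewrite -!mulrA -normrM /r; case: (e u w) => /=; rewrite ?mul0r ?oppr0 // mul1r.
  by case: ltrP => [/ltr0_norm ->|?]; rewrite ?mul0r ?mul1r ?oppr0 ?opprK.
apply: le_trans lower; rewrite lerN2 dE.
have /andP[b0 b1] := dual_cheeger_bounds.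
apply: adj_form_le_threshold => //; first by move=> u w /andP[].
  by rewrite subr_ge0 b1 gerBl b0.
move=> t t0; set S := [set v | _]; rewrite /=.
pose S1 := [set v in S | 0 < g v]; pose S2 := [set v in S | g v < 0].
have dis : [disjoint S1 & S2].
  by rewrite -setI_eq0; apply/eqP/setP => v; rewrite !inE; case: ltrgtP; rewrite !andbF.
have indE v : ind S v = ind S1 v + ind S2 v.
  rewrite /indicator !inE; case: ltrgtP; rewrite ?andbF ?andbT ?addr0 ?add0r //.
  by move=> <-; rewrite normr0 expr0n /= leNgt t0.
have -> : adj_form r (ind S) (ind S) = 2 * (num_edges e S1 S2)%:R.
  transitivity (adj_form e (ind S1) (ind S2) + adj_form e (ind S2) (ind S1)).
    rewrite -big_split; apply: eq_bigr => u _; rewrite -big_split.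
    apply: eq_bigr => w _ /=; rewrite /r /indicator !inE mulr_lt0.
    case: (e u w); case: (t <= `|g u| ^+ 2); case: (t <= `|g w| ^+ 2);
      case: (ltrgtP (g u) 0) => _; case: (ltrgtP (g w) 0) => _ /=;
      by rewrite ?(mulr0, mul0r, mulr1, mul1r, addr0, add0r).
  by rewrite num_edgesE // (adj_formC (ind S2)) //; ring.
have := dual_cheeger_ge dis.
suff -> : (vol e S)%:R = (vol e S1)%:R + (vol e S2)%:R :> R by lra.
by rewrite !volE -big_split; apply: eq_bigr => u _; rewrite indE mulrDr.
Qed.

End Combinatorics.

(** * The spectrum of the Laplacian *)

Lemma map_real_inj (R : rcfType) m n :
  injective (map_mx (real_complex R) : 'M_(m, n) -> 'M_(m, n)).
Proof. by apply: map_mx_inj; apply: fmorph_inj. Qed.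

Lemma realmx_map (R : rcfType) m n (A : 'M[R[i]]_(m, n)) :
  A \is a mxOver Num.real -> exists B : 'M[R]_(m, n), A = map_mx (real_complex R) B.
Proof.
move=> /mxOverP Ar; exists (map_mx (@complex.Re R) A).
by apply/matrixP => i j; rewrite !mxE RRe_real.
Qed.

(** Over the complex numbers a real symmetric matrix is Hermitian, so it is
    similar to a real diagonal matrix; two real matrices that are similar over
    the complex numbers are similar over the reals. *)
Lemma symmetric_diagonalizable (R : rcfType) n (A : 'M[R]_n) : A^T = A ->
  exists2 P : 'M[R]_n, P \in unitmx & exists d : 'rV[R]_n, P *m A = diag_mx d *m P.
Proof.
move=> Asym; set rc := real_complex R; pose C := map_mx rc A.
have Creal : C \is a mxOver Num.real.
  by apply/mxOverP => i j; rewrite mxE complex_real.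
have Csym : C \is symmetricmx.
  apply/is_hermitianmxP; rewrite expr0 scale1r.
  by apply/matrixP => i j; rewrite !mxE -{1}Asym mxE.
have Cherm : C \is hermsymmx by apply: realsym_hermsym.
have dreal := hermitian_spectral_diag_real Cherm.
have /orthomx_spectralP := hermitian_normalmx Cherm.
have Uu := spectral_unit C; set U := spectralmx C in Uu *.
set d := spectral_diag C in dreal * => Ceq.
have Dreal : diag_mx d \is a mxOver Num.real.
  apply/mxOverP => i j; rewrite mxE.
  by case: eqP => _; rewrite ?mulr1n ?mulr0n ?rpred0 // (mxOverP _).
have sim : similar_in unitmx C (diag_mx d).
  by exists U => //; apply/similarP => //; rewrite {1}Ceq !mulmxA mulmxV // mul1mx.
have [P /andP[/= Preal Pu]] := real_similar sim Creal Dreal.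
move=> /(similarP Pu) PC.
have [P' P'E] := realmx_map Preal; have [d' d'E] := realmx_map dreal.
exists P'; first by move: Pu; rewrite P'E map_unitmx.
exists d'; apply: map_real_inj.
by rewrite !map_mxM /= -P'E map_diag_mx -d'E.
Qed.

Lemma char_poly_conj (F : fieldType) n (A B P : 'M[F]_n) :
  P \in unitmx -> P *m A = B *m P -> char_poly A = char_poly B.
Proof.
move=> Pu PAB.
have detP : \det (map_mx polyC P) != 0.
  by rewrite det_map_mx polyC_eq0 -unitfE -unitmxE.
apply: (mulfI detP); rewrite /char_poly [RHS]mulrC -!det_mulmx; congr (\det _).
rewrite /char_poly_mx mulmxBr mulmxBl -!map_mxM PAB; congr (_ - _).
by rewrite scalar_mxC.
Qed.

(** A split characteristic polynomial has no further real roots, so the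
    multiplicities in the spectrum are those of the list s. *)
Lemma perm_spectrum (R : realType) n (M : 'M[R]_n) (s : seq R) :
  char_poly M = \prod_(x <- s) ('X - x%:P) -> perm_eq (spectrum M) s.
Proof.
move=> Ms; apply/allP => x _ /=; apply/eqP; rewrite /spectrum Ms.
set p := \prod_(x <- s) _.
have pn0 : p != 0 by rewrite monic_neq0 // monic_prod_XsubC.
have rp : root p x = (x \in rootsR p).
  by have /(_ x) := roots_on_rootsR pn0; rewrite inE /= => <-.
have ru : uniq (rootsR p) by apply: uniq_roots.
rewrite -[RHS](mu_prod_XsubC x) -/p count_flatten -map_comp sumnE big_map.
have [xr|xr] := boolP (x \in rootsR p).
  rewrite (bigD1_seq x) //= count_nseq /= eqxx mul1n.
  by rewrite big1 ?addn0 // => y yx; rewrite count_nseq /= (negPf yx).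
rewrite mupNroot ?rp // big1_seq // => y /andP[_ yr].
rewrite /= count_nseq /=; case: eqP => // xy; by rewrite -xy yr in xr.
Qed.

Lemma sorted_spectrum (R : realType) n (M : 'M[R]_n) :
  sorted <=%R (spectrum M).
Proof.
suff flat (m : R -> nat) r : sorted <%R r ->
    sorted <=%R (flatten [seq nseq (m x) x | x <- r]).
  by apply: (flat (fun x => mup x (char_poly M))); apply: sorted_roots.
rewrite !sorted_pairwise; try exact: lt_trans; try exact: le_trans.
elim: r => //= x r IHr /andP[xr /IHr hr].
rewrite pairwise_cat hr andbT; apply/andP; split.
  apply/allrelP => y z; rewrite mem_nseq => /andP[_ /eqP->].
  move=> /flattenP[_ /mapP[t ts ->]]; rewrite mem_nseq => /andP[_ /eqP->].
  by rewrite ltW // (allP xr).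
elim: (m x) => //= k ->; rewrite andbT.
by apply/allP => y; rewrite mem_nseq => /andP[_ /eqP->].
Qed.

(** With Q the square root of the degree matrix, Q L Q^-1 = 1 - Q^-1 A Q^-1 is
    symmetric.  If the rows of P diagonalize Q^-1 A Q^-1, those of P Q^-1 are
    eigenfunctions of the Laplacian; a permutation of the rows puts them in the
    order of the spectrum. *)
Lemma laplacian_eigenbasis (R : realType) (T : finType) (e : rel T) :
  symmetric e -> no_isolated_vertex e ->
  let s := spectrum (laplacian e R) in size s = #|T| /\
  exists2 P : 'M[R]_#|T|, P \in unitmx &
  forall k v, \sum_w (e v w)%:R * P k (enum_rank w) =
     (1 - s`_k) * (degree e v)%:R * P k (enum_rank v).
Proof.
move=> e_sym e_iso s; pose A := adjacency_mx e R; pose n := #|T|.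
pose q (i : 'I_n) : R := Num.sqrt (degree e (enum_val i))%:R.
have q_gt0 i : 0 < q i.
  rewrite sqrtr_gt0 ltr0n; case: (e_iso (enum_val i)) => w ew.
  by apply/card_gt0P; exists w; rewrite inE.
have qn0 i : q i != 0 by rewrite gt_eqF.
have qq i : q i * q i = (degree e (enum_val i))%:R.
  by rewrite -expr2 sqr_sqrtr // ler0n.
pose Q := diag_mx (\row_i q i); pose Qi := diag_mx (\row_i (q i)^-1).
have QQi : Q *m Qi = 1%:M.
  apply/matrixP => i j; rewrite mul_diag_mx !mxE.
  by case: eqVneq => [->|_]; rewrite ?mulr1n ?mulr0n ?mulr0 // divff.
have [Qu Qiu] : Q \in unitmx /\ Qi \in unitmx by apply: mulmx1_unit.
have DE : degree_mx e R = Q *m Q.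
  apply/matrixP => i j; rewrite mul_diag_mx !mxE.
  by case: eqVneq => [->|_]; rewrite ?mulr1n ?mulr0n ?mulr0 // qq.
have QiE : invmx Q = Qi by rewrite -[LHS]mulmx1 -QQi mulmxA mulVmx // mul1mx.
have At : A^T = A by apply/matrixP => i j; rewrite !mxE e_sym.
pose M := Qi *m A *m Qi.
have Mt : M^T = M by rewrite /M !trmx_mul At !tr_diag_mx mulmxA.
have [P Pu [d PM]] := symmetric_diagonalizable Mt.
have QiQ : Qi *m Q = 1%:M by rewrite -QiE mulVmx.
pose B := P *m Q.
have Bu : B \in unitmx by rewrite unitmx_mul Pu Qu.
have DI : invmx (degree_mx e R) = Qi *m Qi.
  rewrite -[LHS]mulmx1 -{1}QQi -[Q]mulmx1 -{1}QQi !mulmxA.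
  by rewrite -[in LHS](mulmxA _ Q Q) -DE mulVmx ?mul1mx // DE unitmx_mul Qu.
pose D' := \row_k (1 - d 0 k).
have BL : B *m laplacian e R = diag_mx D' *m B.
  rewrite /laplacian DI mulmxBr mulmx1.
  have -> : diag_mx D' = 1%:M - diag_mx d.
    by apply/matrixP => i j; rewrite !mxE -mulrnBl.
  rewrite mulmxBl mul1mx; congr (_ - _).
  rewrite /B [in RHS]mulmxA -PM /M !mulmxA -(mulmxA _ Qi Q) QiQ mulmx1.
  by rewrite -(mulmxA _ Q Qi) QQi mulmx1.
have cp : char_poly (laplacian e R) = \prod_(x <- codom (D' 0)) ('X - x%:P).
  rewrite (char_poly_conj Bu BL) char_poly_trig ?diag_mx_is_trig //.
  rewrite big_image; apply: eq_bigr => i _.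
  by rewrite [diag_mx _ _ _]mxE eqxx mulr1n.
have ps : perm_eq s (codom (D' 0)) by apply: perm_spectrum.
have szs : size s = n by rewrite (perm_size ps) size_codom card_ord.
split=> //.
have /tuple_permP[p sE] : perm_eq s [tuple D' 0 i | i < n] by exact: ps.
pose F := P *m Qi.
exists (row_perm p F).
  by rewrite row_permE unitmx_mul unitmx_perm /F unitmx_mul Pu; apply: Qiu.
have FA : F *m A = diag_mx d *m F *m degree_mx e R.
  rewrite DE /F !mulmxA -PM /M !mulmxA -(mulmxA _ Qi Q).
  by rewrite QiQ !mulmx1 -(mulmxA _ Qi Q) QiQ mulmx1.
move=> k v; have /matrixP/(_ (p k) (enum_rank v)) := FA.
rewrite -mulmxA mul_diag_mx mul_mx_diag !mxE enum_rankK.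
under eq_bigr => j _ do rewrite !mxE enum_rankK.
have -> : s`_k = 1 - d 0 (p k).
  rewrite sE /= (nth_map k) ?size_enum_ord //= nth_ord_enum.
  by rewrite tnth_map /= !mxE tnth_ord_tuple.
rewrite subKr -mulrA => H.
transitivity (\sum_j F (p k) j * (e (enum_val j) v)%:R).
  rewrite [RHS](reindex (@enum_rank T)) /=; last first.
    by exists enum_val => x _; rewrite ?enum_rankK ?enum_valK.
  by apply: eq_bigr => w _; rewrite enum_rankK e_sym mulrC !mxE.
by rewrite [_ * \sum_j _]mulrC -H; apply: eq_bigr => j _; rewrite mxE.
Qed.

Lemma laplacian_eigenfunctions (R : realType) (T : finType) (e : rel T) :
  symmetric e -> no_isolated_vertex e ->
  let s := spectrum (laplacian e R) in
  exists f : 'I_#|T| -> T -> R,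
  [/\ forall k v, \sum_w (e v w)%:R * f k w =
        (1 - s`_k) * (degree e v)%:R * f k v,
      forall g, exists c, g =1 comb f c &
      forall c, comb f c =1 (fun=> 0) -> c =1 (fun=> 0)].
Proof.
move=> e_sym e_iso; have [_ [P Pu Peig]] := laplacian_eigenbasis R e_sym e_iso.
exists (fun k v => P k (enum_rank v)); split=> [//|g|c c0 k].
- exists (fun k => ((\row_i g (enum_val i)) *m invmx P) 0 k) => v.
  set G := \row_i _; transitivity ((G *m invmx P *m P) 0 (enum_rank v)).
    by rewrite mulmxKV // mxE enum_rankK.
  by rewrite mxE.
- have : (\row_i c i) *m P = 0.
    apply/rowP => i; rewrite !mxE -[RHS](c0 (enum_val i)) /comb.
    by apply: eq_bigr => j _; rewrite mxE enum_valK.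
  move=> /(congr1 (mulmx^~ (invmx P))); rewrite mulmxK // mul0mx.
  by move=> /rowP/(_ k); rewrite !mxE.
Qed.

Lemma linear_relation (R : comNzRingType) (x y : R) :
  exists a b : R, (a != 0) || (b != 0) /\ a * x + b * y = 0.
Proof.
have [->|x0] := eqVneq x 0.
  by exists 1, 0; rewrite oner_eq0 mulr0 mul0r addr0.
by exists y, (- x); rewrite oppr_eq0 x0 orbT mulNr mulrC subrr.
Qed.

(** * The four spectral inequalities *)

Section Spectral.
Variables (R : realType) (T : finType) (e : rel T).
Hypotheses (e_sym : symmetric e) (e_iso : no_isolated_vertex e).
Let s := spectrum (laplacian e R).
Local Notation n := #|T|.
Variable f : 'I_n -> T -> R.
Hypothesis f_eigen : forall k v,
  \sum_w (e v w)%:R * f k w = (1 - s`_k) * (degree e v)%:R * f k v.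
Hypothesis f_span : forall g, exists c, g =1 comb f c.
Hypothesis f_free : forall c, comb f c =1 (fun=> 0) -> c =1 (fun=> 0).
Local Notation dform := (deg_form e).
Local Notation ind := (@indicator R T).

Lemma size_spectrum : size s = n.
Proof. by have [] := laplacian_eigenbasis R e_sym e_iso. Qed.

Lemma spectrum_le (i j : 'I_n) : (i <= j)%N -> s`_i <= s`_j.
Proof.
move=> ij; apply: (sorted_leq_nth le_trans le_refl) => //.
- exact: sorted_spectrum.
- by rewrite inE size_spectrum.
- by rewrite inE size_spectrum.
Qed.

Lemma eq_forms (f1 f2 : T -> R) : f1 =1 f2 ->
  adj_form e f1 f1 = adj_form e f2 f2 /\ dform f1 f1 = dform f2 f2.
Proof.
move=> eqf; split; first by do 2!apply: eq_bigr => ? _; rewrite !eqf.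
by apply: eq_bigr => ? _; rewrite !eqf.
Qed.

Lemma comb_neq0 c k : c k != 0 -> 0 < dform (comb f c) (comb f c).
Proof.
move=> ck; have [v|all0] := pickP (fun v => comb f c v != 0).
  exact: deg_form_gt0.
have c0 : c =1 (fun=> 0) by apply: f_free => v; apply/eqP/negbFE/all0.
by rewrite c0 eqxx in ck.
Qed.

(** Some nonzero combination of the i-th and j-th eigenfunctions is orthogonal to
    constants.  Using two indices covers the case where the eigenvalue 0 is
    repeated, without deciding which eigenfunction is constant. *)
Lemma eigenvalue_ge_cheeger (i j : 'I_n) : (i < j)%N ->
  1 - s`_j <= Num.sqrt (1 - cheeger e R ^+ 2).
Proof.
move=> ij; pose d k := dform (f k) (fun=> 1).
have [a [b [ab orth]]] := linear_relation (d i) (d j).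
pose c k := if k == i then a else if k == j then b else 0.
have ji : j != i by rewrite neq_ltn ij orbT.
have c_sum (F : 'I_n -> R) : \sum_k c k * F k = a * F i + b * F j.
  rewrite (bigD1 i) //= (bigD1 j) //= big1 => [|k /andP[ki kj]].
    by rewrite /c eqxx (negPf ji) eqxx addr0.
  by rewrite /c (negPf ki) (negPf kj) mul0r.
have gt0 : 0 < dform (comb f c) (comb f c).
  case/orP: ab => [a0|b0]; first by apply: (@comb_neq0 _ i); rewrite /c eqxx.
  by apply: (@comb_neq0 _ j); rewrite /c (negPf ji) eqxx.
have c1 : dform (comb f c) (fun=> 1) = 0.
  rewrite deg_formC deg_form_combr c_sum -orth; congr (_ * _ + _ * _); exact: deg_formC.
rewrite -(ler_pM2r gt0); apply: le_trans (adj_form_le_cheeger e_sym c1).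
apply: (adj_form_comb_ge e_sym f_eigen) => k; rewrite /c.
case: (eqVneq k i) => [-> _|_]; first by apply/spectrum_le/ltnW.
by case: (eqVneq k j) => [-> _ //|_]; rewrite eqxx.
Qed.

Lemma eigenvalue_le_dual_cheeger (j : 'I_n) :
  s`_j - 1 <= Num.sqrt (1 - (1 - dual_cheeger e R) ^+ 2).
Proof.
pose c k : R := (k == j)%:R.
have gt0 : 0 < dform (comb f c) (comb f c).
  by apply: (@comb_neq0 _ j); rewrite /c eqxx oner_eq0.
rewrite -(ler_pM2r gt0) -[leLHS]opprK -mulNr opprB lerNl.
apply: le_trans (adj_form_ge_dual_cheeger e_sym _) _.
apply: (adj_form_comb_le e_sym f_eigen) => k; rewrite /c.
by case: (eqVneq k j) => [->|_] //; rewrite eqxx.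
Qed.

(** The test function g = a 1_S + b 1_~S is chosen with no component on the first
    eigenfunction, so D(g,g) - A(g,g) >= s_1 D(g,g).  The left side is
    (a - b)^2 e(S,~S) <= 2 (a^2 + b^2) e(S,~S), while D(g,g) is at least
    (a^2 + b^2) times the smaller volume. *)
Lemma second_eigenvalue_le (j : 'I_n) (S : {set T}) : j = 1%N :> nat ->
  S != set0 -> S \proper [set: T] ->
  s`_j <= 2 * ((num_edges e S (~: S))%:R / (minn (vol e S) (vol e (~: S)))%:R).
Proof.
move=> j1 S0 ST; have n0 : (0 < n)%N by rewrite (leq_trans _ (ltn_ord j)).
pose i0 : 'I_n := Ordinal n0.
have [c1 c1E] := f_span (ind S); have [c2 c2E] := f_span (ind (~: S)).
have [a [b [ab orth]]] := linear_relation (c1 i0) (c2 i0).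
pose g v := a * ind S v + b * ind (~: S) v.
pose c k := a * c1 k + b * c2 k.
have gE : g =1 comb f c.
  move=> v; rewrite /g c1E c2E /comb !mulr_sumr -big_split.
  by apply: eq_bigr => k _; rewrite /c /=; ring.
have [rE dE] := eq_forms gE.
have cmp : adj_form e g g <= (1 - s`_j) * dform g g.
  rewrite rE dE; apply: (adj_form_comb_le e_sym f_eigen) => k ck.
  apply: spectrum_le; rewrite j1 lt0n; apply: contraNneq ck => k0.
  by rewrite (_ : k = i0) ?[c _]orth //; apply: val_inj.
have dgE : dform g g = a ^+ 2 * (vol e S)%:R + b ^+ 2 * (vol e (~: S))%:R.
  rewrite !volE !mulr_sumr -big_split; apply: eq_bigr => u _ /=.
  rewrite /g indicatorC.
  by have [->|->] := indicator01 R S u; ring.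
have rgE : dform g g - adj_form e g g = (a - b) ^+ 2 * (num_edges e S (~: S))%:R.
  rewrite dgE !vol_split setCK num_edgesE; last by rewrite -setI_eq0 setICr.
  have -> : adj_form e g g = a ^+ 2 * adj_form e (ind S) (ind S) +
      a * b * adj_form e (ind S) (ind (~: S)) + a * b * adj_form e (ind (~: S)) (ind S) +
      b ^+ 2 * adj_form e (ind (~: S)) (ind (~: S)).
    rewrite /adj_form !mulr_sumr -!big_split; apply: eq_bigr => u _ /=.
    by rewrite !mulr_sumr -!big_split; apply: eq_bigr => w _ /=; rewrite /g; ring.
  by rewrite (adj_formC (ind (~: S)) (ind S)) //; ring.
have vol_gt0 S' : S' != set0 -> (0 < vol e S')%N.
  move=> /set0Pn[v vS']; rewrite /vol (bigD1 v) //= ltn_addr //.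
  exact: degree_gt0.
set E := (num_edges _ _ _)%:R in rgE *; set m := minn _ _.
have m0 : 0 < m%:R :> R.
  rewrite ltr0n leq_min !vol_gt0 //; apply: contraTneq ST => SC0.
  by rewrite -[S]setCK SC0 setC0 properxx.
have m1 : m%:R <= (vol e S)%:R :> R by rewrite ler_nat geq_minl.
have m2 : m%:R <= (vol e (~: S))%:R :> R by rewrite ler_nat geq_minr.
have E0 : 0 <= E by apply: ler0n.
have [neg|/ltW pos] := lerP (s`_j) 0.
  by rewrite (le_trans neg) // mulr_ge0 ?divr_ge0 // ltW.
have ab0 : 0 < a ^+ 2 + b ^+ 2.
  by rewrite lt_def addr_ge0 ?sqr_ge0 // paddr_eq0 ?sqr_ge0 // !sqrf_eq0 negb_and ab.
rewrite mulrA ler_pdivlMr // -(ler_pM2l ab0).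
have D1 : (a ^+ 2 + b ^+ 2) * m%:R <= dform g g.
  by rewrite dgE mulrDl lerD // ler_wpM2l ?sqr_ge0.
have D2 : s`_j * dform g g <= (a - b) ^+ 2 * E by rewrite -rgE; lra.
have D3 : (a - b) ^+ 2 * E <= 2 * (a ^+ 2 + b ^+ 2) * E.
  by rewrite ler_wpM2r // -subr_ge0 (_ : _ - _ = (a + b) ^+ 2) ?sqr_ge0 //; ring.
have D4 := ler_wpM2l pos D1; lra.
Qed.

(** For g = 1_S1 - 1_S2, D(g,g) = vol(S1) + vol(S2).  Each edge between S1 and S2
    contributes 4 to D(g,g) - A(g,g), and no edge contributes negatively. *)
Lemma top_eigenvalue_ge (j : 'I_n) (S1 S2 : {set T}) : n = j.+1 ->
  S1 != set0 -> [disjoint S1 & S2] ->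
  2 * ((2 * num_edges e S1 S2)%N%:R / (vol e S1 + vol e S2)%N%:R) <= s`_j.
Proof.
move=> nj S10 dis; pose g v := ind S1 v - ind S2 v.
have [c gE] := f_span g; have [rE dE] := eq_forms gE.
have cmp : (1 - s`_j) * dform g g <= adj_form e g g.
  rewrite rE dE; apply: (adj_form_comb_ge e_sym f_eigen) => k _.
  by apply: spectrum_le; rewrite -ltnS -nj.
have i12 u : ind S1 u * ind S2 u = 0.
  rewrite /indicator; have [u1|_] := boolP (u \in S1); last by rewrite mul0r.
  by rewrite (disjointFr dis u1) mulr0.
set V := (_ + _)%N.
have dgE : dform g g = V%:R.
  rewrite natrD !volE -big_split; apply: eq_bigr => u _ /=; rewrite /g.
  transitivity ((degree e u)%:R * (ind S1 u ^+ 2 + ind S2 u ^+ 2 - 2 * (ind S1 u * ind S2 u))).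
    by ring.
  by rewrite i12; have [->|->] := indicator01 R S1 u; have [->|->] := indicator01 R S2 u; ring.
have rgE : adj_form e g g <= V%:R - 4 * (num_edges e S1 S2)%:R.
  rewrite -subr_ge0 (_ : _ - _ = \sum_u \sum_w
      (e u w)%:R * ((ind S1 u + ind S2 u) * (1 - (ind S1 w + ind S2 w)))).
    apply: sumr_ge0 => u _; apply: sumr_ge0 => w _; apply: mulr_ge0 => //.
    apply: mulr_ge0; first by rewrite addr_ge0 ?indicator_ge0.
    by have := i12 w; have [->|->] := indicator01 R S1 w; have [->|->] := indicator01 R S2 w; lra.
  transitivity (\sum_u \sum_w (e u w)%:R * ind S1 u + \sum_u \sum_w (e u w)%:R * ind S2 u
     - 2 * adj_form e (ind S1) (ind S2) - 2 * adj_form e (ind S2) (ind S1) - adj_form e g g).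
    by rewrite !sum_edges_l -!volE natrD [adj_form e (ind S2) _]adj_formC // num_edgesE //; ring.
  rewrite /adj_form !mulr_sumr -!sumrN -!big_split; apply: eq_bigr => u _ /=.
  by rewrite !mulr_sumr -!sumrN -!big_split; apply: eq_bigr => w _ /=; rewrite /g; ring.
have V0 : 0 < V%:R :> R.
  have [v vS] := set0Pn _ S10.
  rewrite -dgE; apply: (@deg_form_gt0 _ _ _ _ v) => //.
  by rewrite /g /indicator vS (disjointFr dis vS) subr0 oner_eq0.
rewrite dgE in cmp; rewrite mulrA ler_pdivrMr // natrM; lra.
Qed.

End Spectral.

Theorem proposition3p2 (R : realType) (T : finType) (e : rel T)
    (T_neq0 : (0 < #|T|)%N) (e_sym : symmetric e) (e_irr : irreflexive e)
    (e_iso : no_isolated_vertex e) :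
  let h : R := cheeger_min e R in
  (1 - Num.sqrt (1 - h ^+ 2) <= 1 - tau e R /\ 1 - tau e R <= 2 * h) /\
  (1 - 2 * h <= tau e R /\ tau e R <= Num.sqrt (1 - h ^+ 2)).
Proof.
move=> h.
have [f [f_eigen f_span f_free]] := laplacian_eigenfunctions R e_sym e_iso.
set s := spectrum _ in f_eigen.
have szs : size s = #|T| by have [] := laplacian_eigenbasis R e_sym e_iso.
(* Two vertices are needed for tau to be a maximum over a nonempty list. *)
have T2 : (1 < #|T|)%N.
  have /card_gt0P[v _] := T_neq0; have [w vw] := e_iso v.
  apply/card_gt1P; exists v, w; split=> //.
  by apply: contraTneq vw => ->; rewrite e_irr.
have /andP[h0 h1] := cheeger_bounds R e.
have /andP[d0 d1] := dual_cheeger_bounds R e_sym.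
have tau0 : 0 <= tau e R by apply: bigmax_ge_id.
have tau_ge (k : 'I_#|T|) : (0 < k)%N -> `|1 - s`_k| <= tau e R.
  move=> k0; rewrite /tau -/s; apply: (@le_bigmax_seq _ _ _ _ _ (s`_k) xpredT
    (fun x => `|1 - x|)) => //.
  rewrite -[nat_of_ord k]prednK // -nth_behead mem_nth // size_behead szs.
  by have := ltn_ord k; lia.
have hmin : 0 <= h by rewrite le_min h0 subr_ge0.
have sqrt_mono x : h <= x -> Num.sqrt (1 - x ^+ 2) <= Num.sqrt (1 - h ^+ 2).
  by move=> hx; rewrite ler_wsqrtr // lerD2l lerN2 ler_sqr ?nnegrE // (le_trans hmin).
have upper : tau e R <= Num.sqrt (1 - h ^+ 2).
  rewrite /tau -/s big_seq; apply: bigmax_le => [|x]; first exact: sqrtr_ge0.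
  move=> /(nthP 0)[k]; rewrite size_behead szs nth_behead => kn <-.
  have kT : (k.+1 < #|T|)%N by rewrite -ltn_predRL.
  pose j := Ordinal kT; pose i := Ordinal T_neq0.
  rewrite ler_norml; apply/andP; split.
    rewrite lerNl opprB.
    apply: le_trans (eigenvalue_le_dual_cheeger e_sym e_iso f_eigen f_free j) _.
    by apply: sqrt_mono; rewrite ge_min lexx orbT.
  have ij : (i < j)%N by [].
  apply: le_trans (eigenvalue_ge_cheeger e_sym e_iso f_eigen f_free ij) _.
  by apply: sqrt_mono; rewrite ge_min lexx.
have lower : 1 - tau e R <= 2 * h.
  have -> : 2 * h = Num.min (2 * cheeger e R) (2 * (1 - dual_cheeger e R)).
    by rewrite minr_pMr.
  rewrite le_min; apply/andP; split.
    suff : (1 - tau e R) / 2 <= cheeger e R by lra.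
    apply: le_bigmin => [|S /andP[S0 ST]]; first by lra.
    have := second_eigenvalue_le e_sym e_iso f_eigen f_span (j := Ordinal T2) erefl S0 ST.
    have := tau_ge (Ordinal T2) isT; rewrite ler_norml => /andP[_] /=.
    by rewrite -/s; set x := s`_1; set q := _ / _; lra.
  suff : dual_cheeger e R <= (1 + tau e R) / 2 by lra.
  apply: bigmax_le => [|[S1 S2] /= /and3P[S10 S20 dis]]; first by lra.
  have nT : (#|T|.-1 < #|T|)%N by rewrite prednK.
  have nE : #|T| = (Ordinal nT).+1 by rewrite /= prednK.
  have := top_eigenvalue_ge e_sym e_iso f_eigen f_span nE S10 dis.
  have k0 : (0 < Ordinal nT)%N by rewrite /= -ltnS prednK.
  have := tau_ge _ k0; rewrite ler_norml => /andP[+ _] /=.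
  by rewrite -/s; set x := s`_ _; set q := _ / _; lra.
by do !split; lra.
Qed.
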